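(* Let $N\ge 1$, let $U$ be an $N\times N$ unitary matrix, and let $\rho$ be an $N\times N$ density matrix (positive semidefinite, trace one) with eigenvalues $\lambda_1\ge\lambda_2\ge\dots\ge\lambda_N$, where we set $\lambda_j=0$ for $N<j\le 2N$. Define the probability vectors $p,q\in\mathbb{R}^N$ by $p_i=\langle i|\rho|i\rangle$ and $q_i=\langle i|U^\dagger\rho U|i\rangle$, where $\{|i\rangle\}_{i=1}^N$ is the computational basis. Let $W^{(\lambda)}\in\mathbb{R}^{2N}$ be the vector defined below. Then $$p\oplus q\prec W^{(\lambda)}.$$
   Context: For $k=1,\dots,2N-1$ let $s_k=\max\{\|M\| : M \text{ is a submatrix of } U \text{ with } \#\mathrm{rows}(M)+\#\mathrm{cols}(M)=k+1\}$, where $\|M\|$ is the operator norm (largest singular value); a submatrix is obtained by selecting any subset of rows and any subset of columns. For $k=1,\dots,2N$ define $S_k$ as follows: if $k=2n$, then $S_k=\sum_{j=1}^{n}\lambda_j(1+s_{k-j})+\sum_{j=n+1}^{k}\lambda_j(1-s_{j-1})$; if $k=2n+1$ (with $n\ge 0$), then $S_k=\sum_{j=1}^{n}\lambda_j(1+s_{k-j})+\lambda_{n+1}+\sum_{j=n+2}^{k}\lambda_j(1-s_{j-1})$. Set $S_0=0$ and $W^{(\lambda)}_k=S_k-S_{k-1}$ for $k=1,\dots,2N$. The vector $p\oplus q\in\mathbb{R}^{2N}$ is the concatenation of $p$ and $q$. For real vectors $x,y$ (padded with zeros to a common length $L$), $x\prec y$ means $\sum_{i=1}^m x^{\downarrow}_i\le\sum_{i=1}^m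 y^{\downarrow}_i$ for all $m\le L$ and $\sum_i x_i=\sum_i y_i$, where $x^\downarrow$ denotes the nonincreasing rearrangement of $x$. *)

(* Defs.v *)
From HB Require Import structures.
From mathcomp Require Import all_boot all_order all_algebra.
From mathcomp Require Import complex.
From mathcomp Require Import classical_sets reals.
Set Implicit Arguments. Unset Strict Implicit. Unset Printing Implicit Defensive.
Import Order.TTheory GRing.Theory Num.Theory.
Local Open Scope ring_scope.

Section Defs.
Variable R : realType.
Local Notation C := (R[i]).

Definition adjmx m n (A : 'M[C]_(m, n)) : 'M[C]_(n, m) :=
  \matrix_(i, j) conjc (A j i).

Definition sqmod (z : C) : R := (complex.Re z) ^+ 2 + (complex.Im z) ^+ 2.

Definition vnorm n (x : 'cV[C]_n) : R := Num.sqrt (\sum_i sqmod (x i 0)).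

(* operator norm (largest singular value) of an m x n complex matrix:
   sup of |M x| over unit vectors x (sup of the empty set is 0). *)
Definition opnorm m n (M : 'M[C]_(m, n)) : R :=
  sup [set r | exists x : 'cV[C]_n, vnorm x = 1 /\ r = vnorm (M *m x)]%classic.

(* s_k : max of operator norms of submatrices of U with #rows + #cols = k+1.
   A submatrix is given by strictly increasing row/column selections. *)
Definition smax N (U : 'M[C]_N) (k : nat) : R :=
  sup [set r | exists (m n : nat) (f : 'I_m -> 'I_N) (g : 'I_n -> 'I_N),
        [/\ (m + n = k.+1)%N,
            (forall i j : 'I_m, (i < j)%N -> (f i < f j)%N),
            (forall i j : 'I_n, (i < j)%N -> (g i < g j)%N) &
            r = opnorm (mxsub f g U)]]%classic.

(* S_k, with lam : nat -> R the 1-based eigenvalue sequence and s : nat -> R *)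
Definition Sfun (lam s : nat -> R) (k : nat) : R :=
  if k is 0 then 0 else
  let n := k./2 in
  if odd k then
    \sum_(1 <= j < n.+1) lam j * (1 + s (k - j)%N) + lam n.+1
    + \sum_(n.+2 <= j < k.+1) lam j * (1 - s j.-1)
  else
    \sum_(1 <= j < n.+1) lam j * (1 + s (k - j)%N)
    + \sum_(n.+1 <= j < k.+1) lam j * (1 - s j.-1).

Definition Wfun (lam s : nat -> R) (k : nat) : R := Sfun lam s k - Sfun lam s k.-1.

Definition majorized (x y : seq R) : Prop :=
  let L := maxn (size x) (size y) in
  let xs := sort (>=%R) (x ++ nseq (L - size x) 0) in
  let ys := sort (>=%R) (y ++ nseq (L - size y) 0) in
  (forall m, (m <= L)%N -> \sum_(i < m) xs`_i <= \sum_(i < m) ys`_i)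
  /\ \sum_(v <- x) v = \sum_(v <- y) v.

End Defs.

(* Main.v *)
Require Import Defs.
From HB Require Import structures.
From mathcomp Require Import all_boot all_order all_algebra perm.
From mathcomp Require Import complex.
From mathcomp Require boolp classical_sets.
From mathcomp Require Import reals.
From mathcomp Require Import zify ring lra.
Set Implicit Arguments. Unset Strict Implicit. Unset Printing Implicit Defensive.
Import Order.TTheory GRing.Theory Num.Theory.
Local Open Scope ring_scope.
Local Open Scope sesquilinear_scope.

(* A sum of k entries of p (+) q is tr (rho B D B^* ), where B = [1 | U] and D
   is the coordinate projection onto the k chosen columns.  Expanding rho in its
   eigenbasis and summing by parts reduces the bound by S_k to bounding
   tr (V B D B^* V^* ) for every frame V of t orthonormal rows, by the t-th
   partial sum of the coefficients of lambda in S_k, which is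
     min (t, k) + \sum_(1 <= l <= min (t, k - t)) s_(k - l).
   The Gram matrix B^* B is 1 + H, where H is off-diagonal with block U, and a
   unit vector supported on j + 1 coordinates has H-form at most s_j.  Choosing
   an orthonormal basis of the frame whose l-th vector avoids l - 1 of the chosen
   coordinates settles t <= k - t.  Otherwise one subtracts from k the
   contribution of k - t orthonormal vectors Z of the coordinate space orthogonal
   to the frame; as diag (1, -1) anticommutes with H, the form of -H on Z is the
   form of H on a reflected frame, to which the same argument applies. *)

(** * Orthonormal frames and traces of compressions *)

Section Frames.
Context {C : numClosedFieldType}.

Lemma conjTM m n p (A : 'M[C]_(m, n)) (B : 'M_(n, p)) :
  (A *m B)^t* = B^t* *m A^t*.
Proof. by rewrite trmx_mul map_mxM. Qed.

(** Gram-Schmidt on a basis of the left kernel of [G], cut to its first [r] rows. It supplies the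
    frames found below by counting linear conditions. *)
Lemma unitary_kernel m n r (G : 'M[C]_(m, n)) :
  (r <= m - \rank G)%N ->
  exists2 Z : 'M[C]_(r, m), Z \is unitarymx & Z *m G = 0.
Proof.
move=> le_r; have le_rk : (r <= \rank (kermx G))%N by rewrite mxrank_ker.
set K := kermx G in le_rk; set Q := schmidt (row_base K).
have Qu : Q \is unitarymx by rewrite schmidt_unitarymx// rank_leq_col.
have QG : Q *m G = 0.
  apply/sub_kermxP; rewrite (eqmx_schmidt_free (row_base_free K)).
  by rewrite eq_row_base.
exists (rowsub (widen_ord le_rk) Q).
  apply/row_unitarymxP => i j; rewrite !row_rowsub.
  by rewrite (row_unitarymxP Qu).
by rewrite mul_rowsub_mx QG; apply/matrixP => i j; rewrite !mxE.
Qed.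

Lemma conjT_col_mx m1 m2 n (A : 'M[C]_(m1, n)) (B : 'M_(m2, n)) :
  (col_mx A B)^t* = row_mx (A^t*) (B^t*).
Proof. by rewrite tr_col_mx map_row_mx. Qed.

Lemma conjT_row_mx m n1 n2 (A : 'M[C]_(m, n1)) (B : 'M_(m, n2)) :
  (row_mx A B)^t* = col_mx (A^t*) (B^t*).
Proof. by rewrite tr_row_mx map_col_mx. Qed.

Lemma conjT1 n : (1%:M : 'M[C]_n)^t* = 1%:M.
Proof. by rewrite trmx1 map_mx1. Qed.

(* In a (t+1)-frame there is a unit vector orthogonal to b_0, ..., b_(t-1);
   split it off and rotate the rest of the frame into its complement. *)
Lemma frame_trace_le d t (K : 'M[C]_d) (b : nat -> 'rV[C]_d) (beta : nat -> C)
    (V : 'M[C]_(t, d)) :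
  (forall j (w : 'rV[C]_d), (j < t)%N -> w \is unitarymx ->
     (forall i, (i < j)%N -> w *m (b i)^t* = 0) ->
     (w *m K *m w^t*) 0 0 <= beta j) ->
  V \is unitarymx -> \tr (V *m K *m V^t*) <= \sum_(j < t) beta j.
Proof.
elim: t V => [|t IHt] V Kle Vu.
  by rewrite /mxtrace !big_ord0.
pose G := V *m (\matrix_(i < t) b i)^t*.
have [c cu cG] : exists2 c : 'rV_t.+1, c \is unitarymx & c *m G = 0.
  by apply: unitary_kernel; rewrite subn_gt0 ltnS rank_leq_col.
have [Z Zu Zc] : exists2 Z : 'M_(t, t.+1), Z \is unitarymx & Z *m c^t* = 0.
  apply: unitary_kernel.
  by have /leq_sub2l := rank_leq_col (c^t*); move/(_ t.+1); rewrite subn1.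
pose Q : 'M[C]_(1 + t) := col_mx c Z.
have Qu : Q \is unitarymx.
  apply/unitarymxP; rewrite conjT_col_mx mul_col_row (unitarymxP cu).
  rewrite (unitarymxP Zu) Zc.
  suff -> : c *m Z^t* = 0 by rewrite -scalar_mx_block.
  by rewrite -[LHS]trmxCK conjTM trmxCK Zc !raddf0.
have QQ : Q^t* *m Q = 1%:M by apply: mulmx1C; apply/unitarymxP.
have -> : \tr (V *m K *m V^t*)
        = \tr (Q *m (V *m K *m V^t*) *m Q^t*).
  by rewrite [RHS]mxtrace_mulC mulmxA QQ mul1mx.
have -> : \tr (Q *m (V *m K *m V^t*) *m Q^t*)
   = ((c *m V) *m K *m (c *m V)^t*) 0 0 + \tr ((Z *m V) *m K *m (Z *m V)^t*).
  rewrite conjT_col_mx mul_col_mx mul_col_row mxtrace_block !conjTM !mulmxA.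
  by rewrite [in LHS]/mxtrace big_ord1.
(* The split-off vector [c *m V] takes the last bound [beta t], being orthogonal to all of the first
   [t] vectors of [b]; the rotated rest is left to the induction. *)
rewrite big_ord_recr /= addrC lerD //.
  apply: Kle; rewrite ?mul_unitarymx// => i it.
  have /matrixP/(_ 0 (Ordinal it)) := cG.
  rewrite /G mulmxA !mxE => h; apply/matrixP => a a'; rewrite !ord1 [RHS]mxE -h.
  by rewrite mxE; apply: eq_bigr => k _; rewrite !mxE.
apply: IHt; last by rewrite mul_unitarymx.
by move=> j w jt; apply: Kle; apply: ltnW.
Qed.

Lemma sqnorm_ge0 m n (A : 'M[C]_(m, n)) : 0 <= \tr (A *m A^t*).
Proof.
apply: sumr_ge0 => i _; rewrite mxE; apply: sumr_ge0 => j _.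
by rewrite !mxE mul_conjC_ge0.
Qed.

(** With [Q] the orthogonal projection onto the complement of the row space of [V], the difference
    of the two sides is the squared norm of [Q *m A]. *)
Lemma sqnorm_frame_le t d n (V : 'M[C]_(t, d)) (A : 'M[C]_(d, n)) :
  V \is unitarymx ->
  \tr ((V *m A) *m (V *m A)^t*) <= \tr (A *m A^t*).
Proof.
move=> /unitarymxP Vu; pose Q : 'M[C]_d := 1%:M - V^t* *m V.
have Qadj : Q^t* = Q by rewrite /Q raddfB /= map_mxB conjT1 conjTM trmxCK.
have QQ : Q *m Q = Q.
  rewrite {2}/Q mulmxBr mulmx1 mulmxA /Q mulmxBl mul1mx -(mulmxA (V^t*)) Vu.
  by rewrite mulmx1 subrr mul0mx subr0.
rewrite -subr_ge0; have := sqnorm_ge0 (Q *m A); congr (0 <= _).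
rewrite (conjTM Q) Qadj mulmxA mxtrace_mulC !mulmxA QQ /Q !mulmxBl mul1mx raddfB /=.
by rewrite conjTM mulmxA [X in _ = _ - X]mxtrace_mulC !mulmxA.
Qed.
End Frames.

(** * Compression to chosen coordinates, with [s] abstract until [smax] is substituted for it *)

Section Compression.
Context {C : numClosedFieldType}.

Definition selmx n (S : {set 'I_n}) : 'M[C]_n := diag_mx (\row_i (i \in S)%:R).

Lemma selmx_adj n (S : {set 'I_n}) : (selmx S)^t* = selmx S.
Proof.
rewrite /selmx tr_diag_mx map_diag_mx; congr diag_mx.
by apply/rowP => i; rewrite !mxE rmorph_nat.
Qed.

Lemma selmx_idem n (S : {set 'I_n}) : selmx S *m selmx S = selmx S.
Proof.
rewrite /selmx mulmx_diag; congr diag_mx.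
by apply/rowP => i; rewrite !mxE -natrM mulnb andbb.
Qed.

Lemma mul_selmxE m n (A : 'M[C]_(m, n)) (S : {set 'I_n}) i j :
  (A *m selmx S) i j = A i j * (j \in S)%:R.
Proof. by rewrite mul_mx_diag !mxE. Qed.

Lemma mxtrace_selmx n (S : {set 'I_n}) : \tr (selmx S) = #|S|%:R.
Proof.
rewrite mxtrace_diag -sum1_card natr_sum [RHS]big_mkcond /=.
by apply: eq_bigr => i _; rewrite mxE; case: (i \in S).
Qed.

(** The basis vector of the [k]-th element of [S]; it is the zero row once [k] reaches the size of
    [S]. *)
Definition enum_row n (S : {set 'I_n}) k : 'rV[C]_n :=
  \row_x ((x \in S) && (index x (enum S) == k))%:R.

(** Orthogonality to [enum_row S i] says that the coordinate of [w] at the [i]-th element of [S]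
    vanishes. *)
Lemma mul_selmx_drop n (S : {set 'I_n}) j (w : 'rV[C]_n) :
  (forall i, (i < j)%N -> w *m (enum_row S i)^t* = 0) ->
  w *m selmx S = w *m selmx [set x in drop j (enum S)].
Proof.
move=> w0; apply/rowP => x; rewrite !mul_selmxE inE.
case: (boolP (x \in S)) => xS; last first.
  suff -> : (x \in drop j (enum S)) = false by [].
  by apply: contraNF xS => /mem_drop; rewrite mem_enum.
case: (ltnP (index x (enum S)) j) => [lt_xj|le_jx]; last first.
  suff -> : x \in drop j (enum S) by [].
  have xe : x \in enum S by rewrite mem_enum.
  rewrite -[X in X \in _](nth_index x xe) -(subnKC le_jx) -nth_drop.
  rewrite mem_nth// size_drop.
  by rewrite ltn_sub2r ?index_mem// (leq_ltn_trans le_jx)// index_mem.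
have /matrixP/(_ 0 0) := w0 _ lt_xj; rewrite !mxE (bigD1 x)//= big1 => [|y yx].
  by rewrite !mxE xS eqxx conjC1 mulr1 addr0 => ->; rewrite !mul0r.
rewrite !mxE; case: (boolP (y \in S)) => yS /=; last by rewrite conjC0 mulr0.
case: eqP => [e|]; last by rewrite conjC0 mulr0.
case/eqP: yx; rewrite -(nth_index y (_ : y \in enum S)) ?mem_enum// e.
by rewrite nth_index ?mem_enum.
Qed.

Lemma card_set_drop n (S : {set 'I_n}) j :
  #|[set x in drop j (enum S)]| = (#|S| - j)%N.
Proof.
rewrite cardsE; have /card_uniqP -> : uniq (drop j (enum S)).
  by rewrite drop_uniq ?enum_uniq.
by rewrite size_drop -cardE.
Qed.

Variables (N : nat) (U : 'M[C]_N) (s : nat -> C).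
Hypothesis (UU : U^t* *m U = 1%:M).

Definition basesmx : 'M[C]_(N, N + N) := row_mx 1%:M U.
Definition offmx : 'M[C]_(N + N) := block_mx 0 U (U^t*) 0.
Definition flipmx : 'M[C]_(N + N) := block_mx 1%:M 0 0 (- 1%:M).

Hypothesis s_ge0 : forall j, 0 <= s j.
Hypothesis offmx_le : forall (S : {set 'I_(N + N)}) j (w : 'rV[C]_(N + N)),
  #|S| = j.+1 ->
  ((w *m selmx S) *m offmx *m (w *m selmx S)^t*) 0 0
    <= s j * ((w *m selmx S) *m (w *m selmx S)^t*) 0 0.

Lemma basesmx_gram : basesmx^t* *m basesmx = 1%:M + offmx.
Proof.
rewrite /basesmx conjT_row_mx mul_col_row conjT1 mul1mx mulmx1 mul1mx UU.
rewrite (@scalar_mx_block _ N N) add_block_mx.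
by rewrite !addr0 !add0r.
Qed.

Lemma flipmx_adj : flipmx^t* = flipmx.
Proof.
rewrite /flipmx tr_block_mx map_block_mx !raddf0 conjT1.
by rewrite raddfN /= map_mxN conjT1.
Qed.

Lemma flipmxK : flipmx *m flipmx = 1%:M.
Proof.
rewrite /flipmx mulmx_block !mul0mx !mulmx0 !addr0 !add0r mul1mx.
by rewrite mulNmx mulmxN opprK mul1mx -scalar_mx_block.
Qed.

Lemma flipmx_off : flipmx *m offmx *m flipmx = - offmx.
Proof.
rewrite /flipmx /offmx !mulmx_block opp_block_mx.
by rewrite !(mul1mx, mulmx1, mulNmx, mulmxN, mulmx0, mul0mx, addr0, add0r, oppr0).
Qed.

Lemma flipmx_selmx (S : {set 'I_(N + N)}) :
  flipmx *m selmx S = selmx S *m flipmx.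
Proof.
suff -> : flipmx = diag_mx (row_mx (const_mx 1) (const_mx (-1))).
  by rewrite /selmx !mulmx_diag; congr diag_mx; apply/rowP=> i; rewrite !mxE mulrC.
rewrite diag_mx_row /flipmx; congr block_mx; rewrite diag_const_mx//.
by rewrite raddfN.
Qed.

Lemma mxtrace_selmx_off (S : {set 'I_(N + N)}) : \tr (selmx S *m offmx) = 0.
Proof.
rewrite /mxtrace big1// => i _; rewrite /selmx mul_diag_mx mxE.
suff -> : offmx i i = 0 by rewrite mulr0.
by case: (split_ordP i) => k ->; rewrite ?block_mxEul ?block_mxEdr mxE.
Qed.

(** Put X = w B D, tau = |X|^2 and y = X B^*. Expanding |y - tau w|^2 gives tau^2 <= |y|^2, and the
    Gram matrix gives |y|^2 = X (1 + H) X^* <= (1 + s_j) tau; then tau cancels. *)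
Lemma compression_unit_le (S : {set 'I_(N + N)}) j (w : 'rV[C]_N) :
  #|S| = j.+1 -> w \is unitarymx ->
  ((w *m basesmx *m selmx S) *m (w *m basesmx *m selmx S)^t*) 0 0 <= 1 + s j.
Proof.
move=> cS /unitarymxP wu; set X := w *m basesmx *m selmx S.
set tau := (X *m X^t*) 0 0.
have XX : X *m X^t* = tau%:M by rewrite [LHS]mx11_scalar.
have tau_ge0 : 0 <= tau.
  by have := sqnorm_ge0 X; rewrite XX mxtrace_scalar.
have tauC : tau^* = tau by rewrite conj_Creal// ger0_real.
pose y := X *m basesmx^t*.
have yw : y *m w^t* = tau%:M.
  rewrite -XX {2}/X !conjTM selmx_adj /y /X -!mulmxA; congr (w *m (_ *m _)).
  by rewrite [in RHS]mulmxA selmx_idem.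
have wy : w *m y^t* = tau%:M.
  by rewrite -[LHS]trmxCK conjTM trmxCK yw tr_scalar_mx map_scalar_mx /= tauC.
have yle : (y *m y^t*) 0 0 <= (1 + s j) * tau.
  rewrite /y conjTM trmxCK !mulmxA -[X *m _ *m _]mulmxA basesmx_gram.
  rewrite mulmxDr mulmx1 mulmxDl mxE mulrDl mul1r lerD2l.
  exact: offmx_le.
have : tau * tau <= (y *m y^t*) 0 0.
  have adjy : (y - tau *: w)^t* = y^t* - tau *: w^t*.
    by apply/matrixP => a b; rewrite !mxE rmorphB rmorphM /= tauC.
  have := sqnorm_ge0 (y - tau *: w); rewrite adjy.
  rewrite mulmxBr !mulmxBl -!scalemxAl -!scalemxAr yw wy wu.
  rewrite !scale_scalar_mx mulr1 subrr subr0 raddfB /= mxtrace_scalar.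
  by rewrite /mxtrace big_ord1 subr_ge0.
move=> /le_trans /(_ yle).
have [->|tau_neq0] := eqVneq tau 0; first by rewrite addr_ge0.
by rewrite ler_pM2r// lt_def tau_neq0.
Qed.

Lemma frame_compression_le t (S : {set 'I_(N + N)}) (V : 'M[C]_(t, N)) :
  V \is unitarymx ->
  \tr (V *m (basesmx *m selmx S *m basesmx^t*) *m V^t*)
    <= (minn t #|S|)%:R + \sum_(j < minn t (#|S| - t)) s (#|S| - j.+1)%N.
Proof.
move=> Vu; set k := #|S|; case: (leqP t (k - t)) => tk.
  have -> : minn t k = t by apply/minn_idPl; rewrite (leq_trans tk) ?leq_subr.
  have -> : t%:R + \sum_(j < t) s (k - j.+1)%N
          = \sum_(j < t) (1 + s (k - j.+1)%N).
    by rewrite big_split /= sumr_const card_ord.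
  (* Orthogonality of [w] to this [b i] kills the [i]-th chosen coordinate of [w *m basesmx]. The
     vector that takes [beta j] keeps [k - j] of them, whence the index [k - j.+1] of [s]. *)
  apply: (frame_trace_le (b := fun i => enum_row S i *m basesmx^t*)
            (beta := fun j => 1 + s (k - j.+1)%N)) => // j w jt wu worth.
  have jk : (j < k)%N by lia.
  have drop_w : w *m basesmx *m selmx S
             = w *m basesmx *m selmx [set x in drop j (enum S)].
    apply: mul_selmx_drop => i ij; have := worth i ij.
    by rewrite conjTM trmxCK mulmxA.
  have -> : w *m (basesmx *m selmx S *m basesmx^t*) *m w^t*
     = (w *m basesmx *m selmx S) *m (w *m basesmx *m selmx S)^t*.
    by rewrite !conjTM selmx_adj -!mulmxA [in RHS](mulmxA (selmx S)) selmx_idem.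
  rewrite drop_w; apply: compression_unit_le => //.
  by rewrite card_set_drop -/k subnS prednK// subn_gt0.
set r := (k - t)%N.
have le_k2N : (k <= N + N)%N by rewrite -[X in (_ <= X)%N]card_ord max_card.
(* [Z] has to be orthogonal to the [t] rows of [V *m basesmx] and to vanish off [S]: at most
   [t + (N + N - k)] conditions, which leaves room for [r] vectors. For [t > k] truncation makes [Z]
   empty. *)
have [Z Zu] : exists2 Z : 'M[C]_(r, N + N), Z \is unitarymx &
    Z *m row_mx (basesmx^t* *m V^t*) (colsub (@enum_val _ (mem (~: S))) 1%:M) = 0.
  apply: unitary_kernel; set E := row_mx _ _.
  have cSc : #|~: S| = (N + N - k)%N by rewrite cardsCs setCK card_ord.
  have : (\rank E <= t + (N + N - k))%N by rewrite -cSc rank_leq_col.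
  by rewrite /r; lia.
rewrite mul_mx_row => /eqP; rewrite row_mx_eq0 => /andP[/eqP ZBV /eqP Zout].
have ZS : Z *m selmx S = Z.
  apply/matrixP => a b; rewrite mul_selmxE.
  case: (boolP (b \in S)) => bS; first by rewrite mulr1.
  have bC : b \in ~: S by rewrite inE.
  have /matrixP/(_ a (enum_rank_in bC b)) := Zout.
  by rewrite mulmx_colsub mulmx1 !mxE enum_rankK_in// => ->; rewrite mulr0.
have SZ : selmx S *m Z^t* = Z^t* by rewrite -{2}ZS conjTM selmx_adj.
(* [W] projects onto the part of the coordinate space of [S] orthogonal to [Z]. As [V *m basesmx] is
   orthogonal to [Z], it may replace [selmx S]; then [sqnorm_frame_le] discards [V]. *)
pose W := selmx S - Z^t* *m Z.
have Wadj : W^t* = W by rewrite /W raddfB /= map_mxB selmx_adj conjTM trmxCK.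
have WZ : W *m Z^t* = 0.
  by rewrite mulmxBl SZ -mulmxA (unitarymxP Zu) mulmx1 subrr.
have WS : W *m selmx S = W by rewrite mulmxBl selmx_idem -mulmxA ZS.
have WW : W *m W = W by rewrite {2}/W mulmxBr mulmxA WZ mul0mx subr0.
have VBW : V *m basesmx *m Z^t* = 0.
  by move/(congr1 (fun A => A^t*)): ZBV; rewrite !conjTM !trmxCK trmx0 map_mx0.
have -> : V *m (basesmx *m selmx S *m basesmx^t*) *m V^t*
   = (V *m (basesmx *m W)) *m (V *m (basesmx *m W))^t*.
  rewrite !conjTM Wadj !mulmxA -[_ *m W *m W]mulmxA WW /W mulmxBr mulmxA VBW.
  by rewrite mul0mx subr0.
apply: le_trans (sqnorm_frame_le _ Vu) _.
(* This is the trace of W (1 + H): the ranks give [k - r], and [selmx S *m offmx] is traceless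
   because [offmx] has zero diagonal. *)
have -> : \tr ((basesmx *m W) *m (basesmx *m W)^t*)
        = (k - r)%:R - \tr (Z *m offmx *m Z^t*).
  rewrite conjTM Wadj mulmxA -[_ *m W *m W]mulmxA WW mxtrace_mulC mulmxA.
  rewrite basesmx_gram mxtrace_mulC mulmxDr mulmx1 raddfD /=; congr (_ + _).
    rewrite /W raddfB /= mxtrace_selmx mxtrace_mulC (unitarymxP Zu) mxtrace1.
    by rewrite [RHS]natrB ?leq_subr.
  rewrite /W mulmxBl raddfB /= mxtrace_selmx_off sub0r.
  by rewrite -(mulmxA _ Z) [in LHS]mxtrace_mulC.
have -> : minn t k = (k - r)%N by rewrite /r; lia.
rewrite lerD2l.
(* [frame_trace_le] asks for its bound at every unit vector, so H is cut down to [S]. This is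
   harmless for [Z *m flipmx], which still lies in the coordinate space of [S]. *)
have -> : - \tr (Z *m offmx *m Z^t*)
   = \tr ((Z *m flipmx) *m (selmx S *m offmx *m selmx S) *m (Z *m flipmx)^t*).
  have ZFS : Z *m flipmx *m selmx S = Z *m flipmx.
    by rewrite -mulmxA flipmx_selmx mulmxA ZS.
  have -> : Z *m flipmx *m (selmx S *m offmx *m selmx S) *m (Z *m flipmx)^t*
    = (Z *m flipmx *m selmx S) *m offmx *m (Z *m flipmx *m selmx S)^t*.
    by rewrite [in RHS]conjTM selmx_adj !mulmxA.
  have -> : Z *m flipmx *m selmx S *m offmx *m (Z *m flipmx *m selmx S)^t*
    = Z *m (flipmx *m offmx *m flipmx) *m Z^t*.
    by rewrite ZFS conjTM flipmx_adj !mulmxA.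
  by rewrite flipmx_off mulmxN mulNmx raddfN.
apply: (frame_trace_le (b := fun i => enum_row S i)
            (beta := fun j => s (k - j.+1)%N)) => [j w jr wu worth|].
  have drop_w := mul_selmx_drop worth.
  have -> : w *m (selmx S *m offmx *m selmx S) *m w^t*
     = (w *m selmx S) *m offmx *m (w *m selmx S)^t*.
    by rewrite conjTM selmx_adj !mulmxA.
  rewrite drop_w; apply: le_trans (offmx_le (j := (k - j.+1)%N) _ _) _.
    by rewrite card_set_drop -/k subnS prednK// subn_gt0; lia.
  rewrite ler_piMr//.
  have <- : (w *m w^t*) 0 0 = 1 by rewrite (unitarymxP wu) mxE eqxx.
  rewrite !mxE; apply: ler_sum => i _.
  rewrite mul_selmxE 2!mxE mul_selmxE 2!mxE rmorphM rmorph_nat /= mulrACA -natrM mulnb andbb.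
  by rewrite ler_piMr ?mul_conjC_ge0// lern1 leq_b1.
apply: mul_unitarymx => //; apply/unitarymxP.
by rewrite flipmx_adj flipmxK.
Qed.

End Compression.

(** * Coefficients of S_k, summation by parts, and majorization of lists *)

Section Sums.
Variable R : realType.
Implicit Types (s lam : nat -> R).

(* The coefficient of lambda_j in S_k. *)
Definition Scoef s k j : R :=
  if (j.*2 <= k)%N then 1 + s (k - j)%N
  else if j.*2 == k.+1 then 1
  else if (j <= k)%N then 1 - s j.-1 else 0.

Lemma SfunE lam s k :
  Sfun lam s k = \sum_(1 <= j < k.+1) lam j * Scoef s k j.
Proof.
case: k => [|k]; first by rewrite big_geq.
rewrite /Sfun; set K := k.+1; have := odd_double_half K.
move: K./2 => n eK.
have low : \sum_(1 <= j < n.+1) lam j * Scoef s K j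
         = \sum_(1 <= j < n.+1) lam j * (1 + s (K - j)%N).
  apply: eq_big_nat => j jn; rewrite /Scoef ifT//.
  by case: (odd K) eK => /=; lia.
rewrite -low; case: (odd K) eK => /= eK.
  rewrite [RHS](big_cat_nat (n := n.+1))//=; last by lia.
  rewrite -addrA; congr (_ + _); rewrite [RHS]big_ltn; last by lia.
  congr (_ + _).
    rewrite /Scoef ifF; last by lia.
    by rewrite ifT ?mulr1//; apply/eqP; lia.
  apply: eq_big_nat => j jn; rewrite /Scoef ifF; last by lia.
  by rewrite ifF; [rewrite ifT//|]; lia.
rewrite [RHS](big_cat_nat (n := n.+1))//=; last by lia.
congr (_ + _); apply: eq_big_nat => j jn; rewrite /Scoef ifF; last by lia.
by rewrite ifF; [rewrite ifT//|]; lia.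
Qed.

(** The first coefficients collect [s (k - 1)], [s (k - 2)] and so on; past the middle, each new
    [- s t] cancels the last term collected. *)
Lemma sum_Scoef s k t :
  \sum_(j < t) Scoef s k j.+1
    = (minn t k)%:R + \sum_(j < minn t (k - t)) s (k - j.+1)%N.
Proof.
elim: t => [|t IHt]; first by rewrite !min0n !big_ord0 addr0.
rewrite big_ord_recr /= {}IHt /Scoef.
case: ifPn => [h|h1].
  have -> : minn t k = t by lia.
  have -> : minn t (k - t) = t by lia.
  have -> : minn t.+1 k = t.+1 by lia.
  have -> : minn t.+1 (k - t.+1) = t.+1 by lia.
  by rewrite big_ord_recr /= -natr1; lra.
case: ifPn => [/eqP h2|h2].
  have -> : minn t k = t by lia.
  have -> : minn t (k - t) = t by lia.
  have -> : minn t.+1 k = t.+1 by lia.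
  have -> : minn t.+1 (k - t.+1) = t by lia.
  by rewrite -natr1; lra.
case: ifPn => [h3|h3].
  have -> : minn t k = t by lia.
  have -> : minn t (k - t) = (k - t.+1).+1 by lia.
  have -> : minn t.+1 k = t.+1 by lia.
  have -> : minn t.+1 (k - t.+1) = (k - t.+1)%N by lia.
  rewrite big_ord_recr /=; have -> : (k - (k - t.+1).+1)%N = t by lia.
  by rewrite -natr1; lra.
have -> : minn t k = k by lia.
have -> : minn t (k - t) = 0%N by lia.
have -> : minn t.+1 k = k by lia.
have -> : minn t.+1 (k - t.+1) = 0%N by lia.
by rewrite addr0.
Qed.

Lemma abel_le n lam (c d : nat -> R) :
  (forall i, 0 <= lam i) -> (forall i, lam i.+1 <= lam i) ->
  (forall t, (t <= n)%N -> \sum_(j < t) d j <= \sum_(j < t) c j) ->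
  \sum_(j < n) lam j * d j <= \sum_(j < n) lam j * c j.
Proof.
move=> lam_ge0 lam_noninc dc; rewrite -subr_ge0 -sumrB.
(* Strengthened for the induction: the gap is at least [lam n] times the gap between the partial
   sums of [c] and [d]. *)
suff : lam n * (\sum_(j < n) c j - \sum_(j < n) d j)
         <= \sum_(j < n) (lam j * c j - lam j * d j).
  by apply: le_trans; rewrite mulr_ge0// subr_ge0 dc.
elim: n dc => [|n IHn] dc; first by rewrite !big_ord0 subrr mulr0.
have {}IHn := IHn (fun t tn => dc t (leqW tn)).
have Xge0 : 0 <= \sum_(j < n.+1) c j - \sum_(j < n.+1) d j by rewrite subr_ge0 dc.
apply: le_trans (ler_wpM2r Xge0 (lam_noninc n)) _.
rewrite !big_ord_recr /=; lra.
Qed.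

(** Take the entry of [x] at index [m] as threshold. The positive excesses of all entries over it
    total exactly the first [m] differences of [x], and at least any [m] differences of [y]. *)
Lemma prefix_sum_le_sorted (x y : seq R) m :
  perm_eq x y -> sorted (>=%R) x -> (m <= size x)%N ->
  \sum_(i < m) y`_i <= \sum_(i < m) x`_i.
Proof.
move=> xy srt mx; have sxy := perm_size xy.
have sum_take (z : seq R) : (m <= size z)%N ->
    \sum_(i < m) z`_i = \sum_(v <- take m z) v.
  move=> mz; rewrite (big_nth 0) size_takel// big_mkord.
  by apply: eq_bigr => i _; rewrite nth_take.
have := mx; rewrite leq_eqVlt => /orP[/eqP em|lt_mx].
  rewrite !sum_take -?sxy// !take_oversize -?sxy ?em//.
  by rewrite (perm_big _ xy).
pose th := x`_m; pose g v := Num.max (v - th) 0.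
have gx : \sum_(v <- x) g v = \sum_(i < m) (x`_i - th).
  rewrite (big_nth 0) big_mkord -(subnKC mx) big_split_ord /= [X in _ + X]big1.
    rewrite addr0; apply: eq_bigr => i _; rewrite /g max_l// subr_ge0 /th.
    by apply: (sorted_leq_nth ge_trans lexx 0 srt); rewrite ?inE ?(ltn_trans (ltn_ord i))// ltnW.
  move=> i _; rewrite /g max_r// subr_le0 /th.
  apply: (sorted_leq_nth ge_trans lexx 0 srt); rewrite ?inE ?leq_addr//.
  by rewrite -[ltnRHS](subnKC mx) ltn_add2l.
have gy : \sum_(i < m) (y`_i - th) <= \sum_(v <- y) g v.
  rewrite (big_nth 0) -sxy -[size x](subnKC mx) big_mkord.
  rewrite big_split_ord /= -[leLHS]addr0 lerD//.
    by apply: ler_sum => i _; rewrite /g le_max lexx.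
  by apply: sumr_ge0 => i _; rewrite /g le_max lexx orbT.
by move: gy; rewrite -(perm_big _ xy) /= gx !sumrB lerD2r.
Qed.

(** The first [m] entries of the sorted list are the values of [F] on some set of [m] indices, and
    sorting [y] only raises its prefix sums. *)
Lemma majorized_map n (F : 'I_n -> R) (y : seq R) :
  size y = n ->
  (forall S : {set 'I_n}, \sum_(i in S) F i <= \sum_(i < #|S|) y`_i) ->
  \sum_i F i = \sum_(v <- y) v ->
  majorized [seq F i | i <- enum 'I_n] y.
Proof.
move=> sy Fle Fsum; split; last by rewrite big_map -Fsum big_enum.
rewrite size_map size_enum_ord sy maxnn subnn !cats0 => m mn.
apply: (@le_trans _ _ (\sum_(i < m) y`_i)); last first.
  apply: prefix_sum_le_sorted; first exact: permEl (perm_sort _ _).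
    by apply: sort_sorted; exact: ge_total.
  by rewrite size_sort sy.
rewrite sort_map; set e := sort _ _.
have se : size e = n by rewrite size_sort size_enum_ord.
have ue : uniq (take m e) by rewrite take_uniq// sort_uniq enum_uniq.
have := Fle [set x in take m e].
have -> : #|[set x in take m e]| = m.
  by rewrite cardsE (card_uniqP ue) size_takel// se.
apply: le_trans.
rewrite (eq_bigl (fun x => x \in take m e)); last by move=> x; rewrite inE.
rewrite -big_uniq//= -(big_map F xpredT id) (big_nth 0) map_take big_mkord.
rewrite size_takel ?size_map ?se// le_eqVlt; apply/orP; left; apply/eqP.
by apply: eq_bigr => i _; rewrite nth_take.
Qed.

Lemma sum_Wfun lam s m :
  \sum_(i < m) Wfun lam s i.+1 = Sfun lam s m.
Proof.
by rewrite -(big_mkord xpredT (fun i => Wfun lam s i.+1)) telescope_sumr// subr0.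
Qed.

End Sums.

(** * Operator norms of submatrices of U, and the bound on the form of H *)

Section Smax.
Variable R : realType.
Local Notation C := (R[i]).

Lemma adjmxE m n (A : 'M[C]_(m, n)) : adjmx A = A^t*.
Proof. by apply/matrixP => i j; rewrite !mxE. Qed.

Lemma vnorm_ge0 n (x : 'cV[C]_n) : 0 <= vnorm x.
Proof. exact: sqrtr_ge0. Qed.

Lemma vnormE n (x : 'cV[C]_n) : ((vnorm x ^+ 2)%:C)%C = \tr (x *m x^t*).
Proof.
rewrite sqr_sqrtr; last by apply: sumr_ge0 => i _; rewrite addr_ge0 ?sqr_ge0.
rewrite rmorph_sum; apply: eq_bigr => i _; rewrite mxE big_ord1 !mxE.
by rewrite -normCK -add_Re2_Im2.
Qed.

Lemma vnorm_le n m (x : 'cV[C]_n) (y : 'cV[C]_m) :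
  (vnorm x <= vnorm y) = (\tr (x *m x^t*) <= \tr (y *m y^t*)).
Proof. by rewrite -!vnormE lecR ler_sqr ?nnegrE ?vnorm_ge0. Qed.

Lemma vnormZ n (c : R) (x : 'cV[C]_n) :
  0 <= c -> vnorm ((c%:C)%C *: x) = c * vnorm x.
Proof.
move=> c_ge0; apply/eqP; rewrite -(eqrXn2 (n := 2)) ?vnorm_ge0 ?mulr_ge0 ?vnorm_ge0//.
apply/eqP/complexI; rewrite vnormE exprMn rmorphM /= vnormE.
have -> : ((c%:C)%C *: x)^t* = (c%:C)%C *: x^t*.
  apply/matrixP => i j; rewrite !mxE rmorphM /=; congr (_ * _).
  exact: conjc_real.
by rewrite -scalemxAl -scalemxAr !mxtraceZ mulrA -expr2 -rmorphXn.
Qed.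

(** Includes the value 0 that [sup] takes on a set without supremum, as for [opnorm] of a matrix
    with no columns. *)
Lemma sup_ge0_le1 (E : classical_sets.set R) :
  (forall r, E r -> 0 <= r <= 1) -> 0 <= sup E <= 1.
Proof.
move=> E01; have [hE|nE] := boolp.pselect (classical_sets.has_sup E); last by rewrite sup_out// lexx ler01.
case: (hE) => -[r Er] _; apply/andP; split.
  by have /andP[r0 _] := E01 _ Er; apply: le_trans r0 _; apply: (ub_le_sup hE.2).
by apply: ge_sup; [exists r | move=> r' /E01/andP[]].
Qed.

Section Contraction.
Variables (m n : nat) (M : 'M[C]_(m, n)).
Hypothesis Mle : forall x : 'cV_n, vnorm (M *m x) <= vnorm x.

Lemma opnorm_ge0_le1 : 0 <= opnorm M <= 1.
Proof.
by apply: sup_ge0_le1 => _ [x [x1 ->]]; rewrite vnorm_ge0 -x1 Mle.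
Qed.

Lemma vnorm_mulmx_le (x : 'cV_n) : vnorm (M *m x) <= opnorm M * vnorm x.
Proof.
have [x0|x0] := eqVneq (vnorm x) 0; first by rewrite x0 mulr0 -x0 Mle.
have xgt0 : 0 < vnorm x by rewrite lt_def x0 vnorm_ge0.
rewrite -ler_pdivrMr// mulrC -vnormZ ?invr_ge0 ?vnorm_ge0// scalemxAr.
apply: ub_le_sup; first by exists 1 => _ [y [y1 ->]]; rewrite -y1 Mle.
exists (((vnorm x)^-1%:C)%C *: x); split=> //.
by rewrite vnormZ ?invr_ge0 ?vnorm_ge0// mulVf.
Qed.
End Contraction.

Lemma rowsub1_unitary m n (f : 'I_m -> 'I_n) :
  injective f -> rowsub f (1%:M : 'M[C]_n) \is unitarymx.
Proof.
move=> f_inj; apply/row_unitarymxP => i j; rewrite !row_rowsub.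
have /row_unitarymxP -> : (1%:M : 'M[C]_n) \is unitarymx.
  by apply/unitarymxP; rewrite conjT1 mulmx1.
by rewrite (inj_eq f_inj).
Qed.

(** Selections become frames of standard basis vectors, orthonormal for injective [f] and [g], so
    the lemmas on unitary matrices apply. *)
Lemma mxsub_rowsub1 n m1 m2 (f : 'I_m1 -> 'I_n) (g : 'I_m2 -> 'I_n) (U : 'M[C]_n) :
  mxsub f g U = rowsub f 1%:M *m U *m (rowsub g 1%:M)^t*.
Proof.
have -> : (rowsub g (1%:M : 'M[C]_n))^t* = colsub g 1%:M.
  apply/matrixP => i j; rewrite !mxE eq_sym.
  by case: (i == g j); rewrite ?rmorph1 ?rmorph0.
rewrite mulmx_colsub mulmx1 mul_rowsub_mx mul1mx.
by apply/matrixP => i j; rewrite !mxE.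
Qed.

Lemma incr_inj m n (f : 'I_m -> 'I_n) :
  (forall i j : 'I_m, (i < j)%N -> (f i < f j)%N) -> injective f.
Proof.
move=> f_incr i j fij.
by case: (ltngtP i j) => [/f_incr|/f_incr|/val_inj//]; rewrite fij ltnn.
Qed.

Lemma enum_val_incr n (A : {set 'I_n}) (i j : 'I_#|A|) :
  (i < j)%N -> (enum_val i < enum_val j)%N.
Proof.
move=> ij; pose x0 := enum_val i.
have srt : sorted ltn [seq val x | x <- enum A].
  rewrite sorted_map; apply: sorted_filter => [? ? ?|]; first exact: ltn_trans.
  by rewrite -enumT -sorted_map val_enum_ord iota_ltn_sorted.
rewrite !(enum_val_nth x0) -!(nth_map x0 0%N) -?cardE ?ltn_ord//.
by apply: (sorted_ltn_nth ltn_trans 0%N srt) => //; rewrite inE size_map -cardE.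
Qed.

Lemma colsub_enum_valK n (A : {set 'I_n}) (x : 'rV[C]_n) :
  (forall i, i \notin A -> x 0 i = 0) ->
  x = colsub (@enum_val _ (mem A)) x *m rowsub (@enum_val _ (mem A)) 1%:M.
Proof.
move=> x0; apply/rowP => i; rewrite mxE.
under eq_bigr do rewrite !mxE.
rewrite -(big_enum_val (A := mem A) (fun k => x 0 k * (k == i)%:R)) /=.
have [iA|iA] := boolP (i \in A).
  rewrite (bigD1 i)//= eqxx mulr1 big1 ?addr0// => k /andP[_ /negPf->].
  by rewrite mulr0.
rewrite x0// big1// => k kA; case: eqP => [ki|]; last by rewrite mulr0.
by rewrite -ki kA in iA.
Qed.

Variables (N : nat) (U : 'M[C]_N).
Hypothesis Uu : U \is unitarymx.

Lemma mxsub_contraction m n (f : 'I_m -> 'I_N) (g : 'I_n -> 'I_N) (x : 'cV_n) :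
  injective f -> injective g -> vnorm (mxsub f g U *m x) <= vnorm x.
Proof.
move=> f_inj g_inj; rewrite mxsub_rowsub1 -!mulmxA vnorm_le.
apply: le_trans (sqnorm_frame_le _ (rowsub1_unitary f_inj)) _.
apply: le_trans (sqnorm_frame_le _ Uu) _.
rewrite conjTM trmxCK mxtrace_mulC -mulmxA [_ *m (_ *m x)]mulmxA.
by rewrite (unitarymxP (rowsub1_unitary g_inj)) mul1mx mxtrace_mulC.
Qed.

Lemma smax_ge0_le1 k : 0 <= smax U k <= 1.
Proof.
apply: sup_ge0_le1 => _ [m [n [f [g [_ fi gi ->]]]]].
by apply: opnorm_ge0_le1 => x; apply: mxsub_contraction; apply: incr_inj.
Qed.

Lemma mxsub_smax_le k m n (f : 'I_m -> 'I_N) (g : 'I_n -> 'I_N) (x : 'cV_n) :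
  (m + n = k.+1)%N ->
  (forall i j : 'I_m, (i < j)%N -> (f i < f j)%N) ->
  (forall i j : 'I_n, (i < j)%N -> (g i < g j)%N) ->
  vnorm (mxsub f g U *m x) <= smax U k * vnorm x.
Proof.
move=> mn fi gi.
have M01 m' n' (f' : 'I_m' -> 'I_N) (g' : 'I_n' -> 'I_N) :
  (forall i j : 'I_m', (i < j)%N -> (f' i < f' j)%N) ->
  (forall i j : 'I_n', (i < j)%N -> (g' i < g' j)%N) ->
  forall y : 'cV_n', vnorm (mxsub f' g' U *m y) <= vnorm y.
  by move=> f'i g'i y; apply: mxsub_contraction; apply: incr_inj.
apply: le_trans (vnorm_mulmx_le (M01 _ _ _ _ fi gi) x) _.
rewrite ler_wpM2r ?vnorm_ge0//; apply: ub_le_sup; last by exists m, n, f, g.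
exists 1 => _ [m' [n' [f' [g' [_ f'i g'i ->]]]]].
by have /andP[] := opnorm_ge0_le1 (M01 _ _ _ _ f'i g'i).
Qed.

(** Take [k - N + 1] rows and all [N] columns, [k + 1] in total. The rows are orthonormal, so the
    norm 1 is attained at the image of a unit vector under the adjoint. This serves the equality of
    the total sums. *)
Lemma smax_eq1 k : (N <= k < 2 * N)%N -> smax U k = 1.
Proof.
move=> kN; apply/le_anti; have /andP[_ ->] /= := smax_ge0_le1 k.
have m_le : ((k - N).+1 <= N)%N by lia.
pose f := widen_ord m_le; have f_inj : injective f by move=> i j [] /val_inj.
pose M := mxsub f id U.
have Mu : M \is unitarymx.
  rewrite [M]mxsub_rowsub1.
  have -> : rowsub id 1%:M = (1%:M : 'M[C]_N) by apply/matrixP => i j; rewrite !mxE.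
  by rewrite conjT1 mulmx1 mul_unitarymx ?rowsub1_unitary.
pose e : 'cV[C]_(k - N).+1 := delta_mx 0 0.
have := @mxsub_smax_le k _ _ f id (M^t* *m e); rewrite -/M mulmxA (unitarymxP Mu) mul1mx.
have e1 : vnorm e = 1.
  apply/eqP; rewrite -(eqrXn2 (n := 2)) ?vnorm_ge0//; apply/eqP/complexI.
  rewrite vnormE expr1n mxtrace_mulC /mxtrace big_ord1 mxE (bigD1 0)//= big1.
    by rewrite !mxE !eqxx rmorph1 mulr1 addr0.
  by move=> i /negPf i0; rewrite !mxE i0 mulr0.
have -> : vnorm (M^t* *m e) = vnorm e.
  apply/eqP; rewrite -(eqrXn2 (n := 2)) ?vnorm_ge0//; apply/eqP/complexI.
  rewrite !vnormE mxtrace_mulC conjTM trmxCK -mulmxA [M *m _]mulmxA (unitarymxP Mu).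
  by rewrite mul1mx mxtrace_mulC.
by rewrite e1 mulr1; apply=> //; lia.
Qed.

(** With z = M y^*, expand |s a - z^*|^2 >= 0, bound |z|^2 by s^2 |y|^2 and divide by s; for s = 0,
    z vanishes. *)
Lemma cross_term_le m n (M : 'M[C]_(m, n)) (s : R) (a : 'rV[C]_m) (y : 'rV[C]_n) :
  0 <= s -> vnorm (M *m y^t*) <= s * vnorm (y^t*) ->
  (a *m M *m y^t*) 0 0 + (y *m M^t* *m a^t*) 0 0
    <= (s%:C)%C * ((a *m a^t*) 0 0 + (y *m y^t*) 0 0).
Proof.
move=> s_ge0; set z := M *m y^t* => zle.
have zz : (z^t* *m z) 0 0 <= (s%:C)%C ^+ 2 * (y *m y^t*) 0 0.
  have tr11 (A : 'M[C]_1) : A 0 0 = \tr A by rewrite /mxtrace big_ord1.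
  have yy : \tr (y *m y^t*) = \tr (y^t* *m y^t*^t*) by rewrite trmxCK mxtrace_mulC.
  rewrite !tr11 [X in X <= _]mxtrace_mulC yy -!vnormE.
  rewrite -rmorphXn -rmorphM lecR -exprMn ler_sqr ?nnegrE ?mulr_ge0 ?vnorm_ge0//.
have adjz : y *m M^t* = z^t* by rewrite conjTM trmxCK.
rewrite adjz -mulmxA -/z.
have [s0|s_neq0] := eqVneq s 0.
  have z0 : z = 0.
    move: zz; rewrite s0 expr0n mul0r mxE => zz.
    have : \sum_j (z^t*) 0 j * z j 0 = 0.
      apply/le_anti; rewrite zz; apply: sumr_ge0 => j _.
      by rewrite !mxE mulrC mul_conjC_ge0.
    move/eqP; rewrite psumr_eq0 => [/allP zj|j _]; last first.
      by rewrite !mxE mulrC mul_conjC_ge0.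
    apply/colP => j; have := zj j (mem_index_enum _).
    by rewrite !mxE mulrC mul_conjC_eq0 => /eqP.
  by rewrite z0 mulmx0 trmx0 map_mx0 mul0mx mxE addr0 s0 mul0r.
have s_gt0 : (0 : C) < (s%:C)%C by rewrite ltcR lt_def s_neq0.
rewrite -(ler_pM2l s_gt0) -subr_ge0.
have := sqnorm_ge0 ((s%:C)%C *: a - z^t*).
have -> : ((s%:C)%C *: a - z^t*)^t* = (s%:C)%C *: a^t* - z.
  apply/matrixP => i j; rewrite !mxE rmorphB rmorphM /= conjCK; congr (_ * _ - _).
  exact: conjc_real.
rewrite /mxtrace big_ord1 mulmxBr !mulmxBl -!scalemxAl -!scalemxAr => h.
apply: le_trans (_ : _ <= ((s%:C)%C ^+ 2 * (y *m y^t*) 0 0 - (z^t* *m z) 0 0) + _) _.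
  by apply: addr_ge0; [rewrite subr_ge0 | exact: h].
rewrite !mxE le_eqVlt; apply/orP; left; apply/eqP.
set t1 := \sum_j _; set t2 := \sum_j _; set t3 := \sum_j _; set t4 := \sum_j _.
ring.
Qed.

(** [S] selects rows [A] and columns [B] of [U] by its two halves. On vectors supported on [S] the
    form of H sees only this submatrix, whose sizes add up to [j + 1] as in [smax U j]. *)
Lemma offmx_smax_le (S : {set 'I_(N + N)}) j (w : 'rV[C]_(N + N)) :
  #|S| = j.+1 ->
  ((w *m selmx S) *m offmx U *m (w *m selmx S)^t*) 0 0
    <= ((smax U j)%:C)%C * ((w *m selmx S) *m (w *m selmx S)^t*) 0 0.
Proof.
move=> cS; pose A := [set i | lshift N i \in S]; pose B := [set i | rshift N i \in S].
set v := w *m selmx S; pose x := lsubmx v; pose y := rsubmx v.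
have ev : v = row_mx x y by rewrite hsubmxK.
have vS i : i \notin S -> v 0 i = 0 by rewrite mul_selmxE => /negPf->; rewrite mulr0.
have ex : x = colsub (@enum_val _ (mem A)) x *m rowsub (@enum_val _ (mem A)) 1%:M.
  by apply: colsub_enum_valK => i; rewrite inE => iS; rewrite mxE vS.
have ey : y = colsub (@enum_val _ (mem B)) y *m rowsub (@enum_val _ (mem B)) 1%:M.
  by apply: colsub_enum_valK => i; rewrite inE => iS; rewrite mxE vS.
have cAB : (#|A| + #|B| = j.+1)%N.
  rewrite -cS -!sum1_card (big_mkcond (mem S)) big_split_ord /=.
  by congr addn; rewrite big_mkcond; apply: eq_bigr => i _; rewrite inE.
have := @cross_term_le _ _ (mxsub enum_val enum_val U) (smax U j)
  (colsub (@enum_val _ (mem A)) x) (colsub (@enum_val _ (mem B)) y).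
have /andP[-> _] := smax_ge0_le1 j; move=> /(_ isT).
move=> /(_ (mxsub_smax_le _ cAB (@enum_val_incr _ A) (@enum_val_incr _ B))).
set f := @enum_val _ _; set g := @enum_val _ _.
have fu : rowsub f (1%:M : 'M[C]_N) \is unitarymx by apply/rowsub1_unitary/enum_val_inj.
have gu : rowsub g (1%:M : 'M[C]_N) \is unitarymx by apply/rowsub1_unitary/enum_val_inj.
rewrite mxsub_rowsub1.
have -> : colsub f x *m (rowsub f 1%:M *m U *m (rowsub g 1%:M)^t*) *m (colsub g y)^t*
  = x *m U *m y^t* by rewrite {2}ex [in RHS]ey conjTM !mulmxA.
have -> : colsub g y *m (rowsub f 1%:M *m U *m (rowsub g 1%:M)^t*)^t* *m (colsub f x)^t*
  = y *m U^t* *m x^t* by rewrite [in RHS]ex {2}ey !conjTM trmxCK !mulmxA.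
have -> : colsub f x *m (colsub f x)^t* = x *m x^t*.
  by rewrite [in RHS]ex conjTM -!mulmxA [rowsub _ _ *m (_ *m _)]mulmxA (unitarymxP fu) mul1mx.
have -> : colsub g y *m (colsub g y)^t* = y *m y^t*.
  by rewrite [in RHS]ey conjTM -!mulmxA [rowsub _ _ *m (_ *m _)]mulmxA (unitarymxP gu) mul1mx.
congr (_ <= _ * _); rewrite ev /offmx conjT_row_mx ?mul_row_block ?mul_row_col.
  by rewrite !mulmx0 addr0 add0r [RHS]mxE addrC.
by rewrite [RHS]mxE.
Qed.

End Smax.

(** * The eigenbasis of a Hermitian matrix in the prescribed order *)

Lemma ordered_spectral (R : realType) N (rho : 'M[R[i]]_N) (lams : seq R) :
  rho^t* = rho -> size lams = N ->
  char_poly rho = \prod_(l <- lams) ('X - (l%:C)%C%:P) ->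
  exists2 P : 'M[R[i]]_N, P \is unitarymx &
    rho = P^t* *m diag_mx (\row_i ((lams`_i)%:C)%C) *m P.
Proof.
move=> rho_herm size_lams char_rho.
have /orthomx_spectralP : rho \is normalmx by apply/normalmxP; rewrite rho_herm.
set P := spectralmx rho; set sp := spectral_diag rho => rhoE.
have Pu : P \is unitarymx by apply: spectral_unitarymx.
have Punit := unitarymx_unit Pu.
have char_sp : char_poly rho = \prod_(z <- [seq sp 0 i | i <- enum 'I_N]) ('X - z%:P).
  rewrite big_map big_enum /= -[RHS](_ : char_poly (diag_mx sp) = _); last first.
    rewrite char_poly_trig; first by apply: eq_bigr => i _; rewrite mxE eqxx.
    by apply/is_trig_mxP => i j ij; rewrite mxE; case: eqP ij => // ->; rewrite ltnn.
  rewrite /char_poly.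
  have -> : char_poly_mx rho = map_mx polyC (invmx P) *m char_poly_mx (diag_mx sp)
                               *m map_mx polyC P.
    rewrite {1}rhoE /char_poly_mx mulmxBr mulmxBl !map_mxM; congr (_ - _).
    by rewrite scalar_mxC -mulmxA -map_mxM mulVmx// map_mx1 mulmx1.
  rewrite !det_mulmx mulrAC -det_mulmx -map_mxM mulVmx// map_mx1 det1 mul1r.
  by [].
(* Both lists are the roots of the characteristic polynomial, so they differ by a permutation [sg],
   which then reorders the rows of the eigenbasis. *)
have /tuple_permP [sg esg] : perm_eq [seq (l%:C)%C | l <- lams]
    [tuple sp 0 i | i < N].
  apply: prod_XsubC_eq; rewrite big_map -char_rho char_sp.
  by rewrite big_map /= big_map.
have lamE (i : 'I_N) : ((lams`_i)%:C)%C = sp 0 (sg i).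
  have : [seq (l%:C)%C | l <- lams]`_i = ((lams`_i)%:C)%C.
    by rewrite (nth_map 0) ?size_lams.
  by rewrite esg -tnth_nth !tnth_mktuple.
exists (row_perm sg P).
  apply/row_unitarymxP => i j.
  have row_row_perm k : row k (row_perm sg P) = row (sg k) P.
    by apply/rowP => l; rewrite !mxE.
  by rewrite !row_row_perm (row_unitarymxP Pu) (inj_eq perm_inj).
rewrite [LHS]rhoE invmx_unitary//; apply/matrixP => a b.
rewrite !mul_mx_diag !mxE (reindex_inj (@perm_inj _ sg)) /=.
by apply: eq_bigr => i _; rewrite !mxE lamE.
Qed.

Lemma Re_sum (R : realType) (I : finType) (A : {pred I}) (F : I -> R[i]) :
  complex.Re (\sum_(i in A) F i) = \sum_(i in A) complex.Re (F i).
Proof. by apply: (big_morph _ _ (erefl _)) => -[a b] [c d]. Qed.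

Lemma ReZ (R : realType) (c : R) (z : R[i]) :
  complex.Re ((c%:C)%C * z) = c * complex.Re z.
Proof. by case: z => a b /=; rewrite mul0r subr0. Qed.

(** * Subset sums of the two distributions against the sums S_k *)

Theorem theorem1 (R : realType) (N : nat) (U rho : 'M[R[i]]_N) (lams : seq R) :
  (1 <= N)%N ->
  (* U unitary *)
  adjmx U *m U = 1%:M -> U *m adjmx U = 1%:M ->
  (* rho density matrix: Hermitian, positive semidefinite, trace one *)
  adjmx rho = rho ->
  (forall x : 'cV[R[i]]_N, complex.Im ((adjmx x *m rho *m x) 0 0) = 0 /\
                            0 <= complex.Re ((adjmx x *m rho *m x) 0 0)) ->
  \tr rho = 1 ->
  (* lams = [lambda_1; ...; lambda_N], the eigenvalues of rho (with
     multiplicity) in nonincreasing order *)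
  size lams = N ->
  sorted (>=%R) lams ->
  char_poly rho = \prod_(l <- lams) ('X - (l%:C)%C%:P) ->
  let lam := fun j : nat => if j is j'.+1 then nth 0 lams j' else 0 in
  let p := [seq complex.Re (rho i i) | i <- enum 'I_N] in
  let q := [seq complex.Re ((adjmx U *m rho *m U) i i) | i <- enum 'I_N] in
  let W := [seq Wfun lam (smax U) k | k <- iota 1 (2 * N)] in
  majorized (p ++ q) W.
Proof.
move=> N_gt0; rewrite !adjmxE => UU UU' rho_herm rho_psd _ size_lams lams_sorted.
move=> char_rho lam p q W.
have Uu : U \is unitarymx by apply/unitarymxP.
have [P Pu rhoE] := ordered_spectral rho_herm size_lams char_rho.
(* The adjoint of row [i] of [P] is a unit eigenvector, at which the form of [rho] is the
   eigenvalue; from [N] on the default is 0. *)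
have lam_ge0 i : 0 <= lams`_i.
  have [iN|] := ltnP i N; last by move=> Ni; rewrite nth_default ?size_lams.
  have [_] := rho_psd ((row (Ordinal iN) P)^t*); rewrite adjmxE trmxCK.
  have -> : (row (Ordinal iN) P *m rho *m (row (Ordinal iN) P)^t*) 0 0
          = (P *m rho *m P^t*) (Ordinal iN) (Ordinal iN).
    by rewrite -row_mul !mxE; apply: eq_bigr => k _; rewrite !mxE.
  rewrite {1}rhoE !mulmxA (unitarymxP Pu) mul1mx -mulmxA (unitarymxP Pu) mulmx1.
  by rewrite !mxE eqxx.
have lam_noninc i : lams`_i.+1 <= lams`_i.
  have [iN|] := ltnP i.+1 N; last by move=> Ni; rewrite [leLHS]nth_default ?size_lams.
  by apply: (sorted_leq_nth ge_trans lexx 0 lams_sorted); rewrite ?inE ?size_lams// ltnW.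
pose B := basesmx U.
pose F i := complex.Re ((B^t* *m rho *m B) i i).
have FE : B^t* *m rho *m B = block_mx rho (rho *m U) (U^t* *m rho) (U^t* *m rho *m U).
  by rewrite /B conjT_row_mx mul_col_mx mul_col_row conjT1 !mul1mx !mulmx1.
have Fp i : F (lshift N i) = complex.Re (rho i i) by rewrite /F FE block_mxEul.
have Fq i : F (rshift N i) = complex.Re ((U^t* *m rho *m U) i i).
  by rewrite /F FE block_mxEdr.
have -> : p ++ q = [seq F i | i <- enum 'I_(N + N)].
  have -> : enum 'I_(N + N) = [seq lshift N i | i <- enum 'I_N]
                           ++ [seq rshift N i | i <- enum 'I_N].
    apply: (inj_map val_inj); rewrite map_cat val_enum_ord iotaD add0n.
    rewrite -[X in _ ++ iota X _]addn0 iotaDl -!val_enum_ord.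
    rewrite -[in RHS](map_comp val (lshift N)) -[in RHS](map_comp val (@rshift N N)).
    by congr (_ ++ _); rewrite -map_comp.
  rewrite map_cat -(map_comp F (lshift N)) -(map_comp F (@rshift N N)).
  congr (_ ++ _); apply: eq_map => i /=.
    by rewrite Fp.
  by rewrite Fq.
(* The squared norm of row [l] of [P *m B] restricted to the coordinates in the set [t]. *)
pose dd t l := complex.Re ((P *m (B *m selmx t *m B^t*) *m P^t*) l l).
have FS (S : {set 'I_(N + N)}) : \sum_(i in S) F i = \sum_(l < N) lams`_l * dd S l.
  transitivity (complex.Re (\tr (B^t* *m rho *m B *m selmx S))).
    rewrite Re_sum [LHS]big_mkcond; apply: eq_bigr => i _.
    by rewrite mul_selmxE; case: (i \in S); rewrite ?mulr1// mulr0.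
  rewrite rhoE -!mulmxA mxtrace_mulC -!mulmxA mxtrace_mulC -!mulmxA Re_sum.
  by apply: eq_bigr => l _; rewrite mul_diag_mx mxE [X in X * _]mxE ReZ /dd !mulmxA.
pose ddn S j := oapp (dd S) 0 (insub j).
have ddnE S (l : 'I_N) : ddn S l = dd S l by rewrite /ddn valK.
have ddle S t : (t <= N)%N ->
    \sum_(j < t) ddn S j <= \sum_(j < t) Scoef (smax U) #|S| j.+1.
  move=> tN; pose V := rowsub (widen_ord tN) P.
  have Vu : V \is unitarymx.
    apply/row_unitarymxP => i j; rewrite !row_rowsub (row_unitarymxP Pu).
    by [].
  have s_ge0 j : 0 <= ((smax U j)%:C)%C.
    by rewrite ler0c; have /andP[] := smax_ge0_le1 Uu j.
  have := frame_compression_le UU s_ge0 (offmx_smax_le Uu) S Vu.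
  rewrite sum_Scoef -rmorph_sum -[_%:R](rmorph_nat (real_complex R)) -rmorphD.
  rewrite lecE => /andP[_] /=; apply: le_trans.
  rewrite Re_sum le_eqVlt; apply/orP; left; apply/eqP; apply: eq_bigr => i _.
  rewrite -[val i]/(val (widen_ord tN i)) ddnE /dd; congr complex.Re.
  rewrite /V mul_rowsub_mx mxE [RHS]mxE; apply: eq_bigr => k _.
  by rewrite !mxE.
(* Both sums are padded to length [k + N]: the coefficients vanish from index [k] on, and the
   eigenvalues, by the default 0, from [N] on. *)
have SfunN k : Sfun lam (smax U) k = \sum_(j < N) lams`_j * Scoef (smax U) k j.+1.
  pose f j := lams`_j * Scoef (smax U) k j.+1.
  have pad a b : (forall j, (a <= j)%N -> f j = 0) ->
      \sum_(j < a) f j = \sum_(j < a + b) f j.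
    move=> f0; rewrite big_split_ord /= [X in _ + X]big1 ?addr0// => j _.
    by rewrite f0 ?leq_addr.
  rewrite SfunE big_add1 big_mkord (pad k N) => [|j kj]; last first.
    by rewrite /f /Scoef !ifF ?mulr0//; lia.
  rewrite addnC -pad// => j Nj.
  by rewrite /f nth_default ?mul0r ?size_lams.
have nthW i : (i < N + N)%N -> W`_i = Wfun lam (smax U) i.+1.
  by move=> iN; rewrite (nth_map 0%N) ?size_iota ?nth_iota; [|lia..].
have sumW k : (k <= N + N)%N -> \sum_(i < k) W`_i = Sfun lam (smax U) k.
  move=> kN; rewrite -sum_Wfun; apply: eq_bigr => i _; rewrite nthW//.
  exact: leq_trans (ltn_ord i) kN.
have sizeW : size W = (N + N)%N by rewrite size_map size_iota; lia.
apply: majorized_map => //.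
  move=> S; rewrite FS sumW; last by rewrite -[leqRHS]card_ord max_card.
  rewrite SfunN; under eq_bigr do rewrite -ddnE.
  apply: (abel_le (lam := fun j => lams`_j)
    (c := fun j => Scoef (smax U) #|S| j.+1)) => // t tN.
  exact: ddle.
rewrite (big_nth 0) big_mkord sizeW sumW// SfunN.
transitivity (\sum_(i in [set: 'I_(N + N)]) F i).
  by apply: eq_bigl => i; rewrite inE.
rewrite FS; apply: eq_bigr => j _; congr (_ * _).
(* With all coordinates chosen, B B^* = 1 + U U^* = 2. The coefficients of S_(2N) are also 2, since
   [smax_eq1] applies to every index [N + N - j.+1]. *)
have -> : dd [set: 'I_(N + N)] j = 2.
  have sel1 : selmx [set: 'I_(N + N)] = 1%:M :> 'M[R[i]]_(N + N).
    by apply/matrixP => a b; rewrite !mxE inE.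
  rewrite /dd sel1 mulmx1 /B conjT_row_mx mul_row_col conjT1 mulmx1 UU'.
  by rewrite mulmxDr mulmx1 mulmxDl (unitarymxP Pu) !mxE eqxx.
have jN := ltn_ord j.
by rewrite /Scoef ifT ?smax_eq1//; lia.
Qed.
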